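(* Let $I\subseteq\mathbb{R}$ be an interval and let $F:I\rightrightarrows\mathbb{R}$ be a lower semicontinuous set-valued function (with nonempty values). Let $J\subseteq I$ be dense in $I$ and assume that $F$ is locally strictly quasimonotone on $J$. Assume further that $0\notin F(x)$ for all $x\in I\setminus J$. Then $F$ is strictly quasimonotone on $I$.
   Context: A set-valued function $F:I\rightrightarrows\mathbb{R}$ assigns to each $x\in I$ a nonempty set $F(x)\subseteq\mathbb{R}$. A set $J\subseteq I$ is dense in $I$ if $I\subseteq \mathrm{cl}(J)$. $F$ is lower semicontinuous if for every $x\in I$ and every open $N\subseteq\mathbb{R}$ with $F(x)\cap N\neq\emptyset$ there is a neighborhood $M$ of $x$ such that $F(y)\cap N\neq\emptyset$ for all $y\in M\cap I$. For a subset $A\subseteq I$, the restriction $F|_A$ is the set-valued function with domain $A$ that agrees with $F$ on $A$. For $a\neq b$ let $(a,b)=\{a+t(b-a):t\in(0,1)\}$ (for either order of $a,b$). Quasimonotone (on $A$): for all $x,y\in A$, $x^*\in F(x)$, $y^*\in F(y)$: $x^*(y-x)>0\Rightarrow y^*(y-x)\ge0$. Strictly quasimonotone (on $A$): quasimonotone on $A$, and for all $x,y\in A$ with $x\ne y$ there exist $z\in(x,y)\cap A$ and $z^*\in F(z)$ with $z^*(y-x)\neq0$. $F$ is locally strictly quasimonotone on $J$ if every $x\in J$ has an open neighborhood $U_x$ such that $F|_{U_x\cap J}$ is strictly quasimonotone. *)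

(* Defs.v *)
From HB Require Import structures.
From mathcomp Require Import all_boot all_order all_algebra.
From mathcomp Require Import all_classical all_reals all_analysis.
Import Order.TTheory GRing.Theory Num.Theory.
Import numFieldNormedType.Exports.

Set Implicit Arguments.
Unset Strict Implicit.
Unset Printing Implicit Defensive.

Local Open Scope classical_set_scope.
Local Open Scope ring_scope.

(** A set-valued function with domain [A] is represented by a total function
    [F : R -> set R] together with [A]: every notion below takes the domain as
    an argument and never consults [F] outside it.  In particular the
    restriction of [F] to [B `<=` A] is [F] itself, considered on [B]. *)

Definition nonempty_valued (R : realType) (A : set R) (F : R -> set R) : Prop :=
  forall x, A x -> F x !=set0.

Definition set_valued_lsc (R : realType) (A : set R) (F : R -> set R) : Prop :=
  forall x, A x -> forall N : set R, open N -> F x `&` N !=set0 ->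
    exists2 M : set R, nbhs x M & forall y, (M `&` A) y -> F y `&` N !=set0.

(** Unlike [`]a, b[], this does not presuppose [a < b]. *)
Definition open_segment (R : realType) (a b : R) : set R :=
  [set a + t * (b - a) | t in `]0, 1[].

Definition quasimonotone (R : realType) (A : set R) (F : R -> set R) : Prop :=
  forall x y, A x -> A y -> forall xs ys, F x xs -> F y ys ->
    0 < xs * (y - x) -> 0 <= ys * (y - x).

Definition strictly_quasimonotone (R : realType) (A : set R)
    (F : R -> set R) : Prop :=
  quasimonotone A F /\
  forall x y, A x -> A y -> x != y ->
    exists2 z, (open_segment x y `&` A) z &
      exists2 zs, F z zs & zs * (y - x) != 0.

Definition locally_strictly_quasimonotone (R : realType) (J : set R)
    (F : R -> set R) : Prop :=
  forall x, J x -> exists U : set R,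
    [/\ open U, U x & strictly_quasimonotone (U `&` J) F].

(* Main.v *)
Require Import Defs.
From HB Require Import structures.
From mathcomp Require Import all_boot all_order all_algebra.
From mathcomp Require Import all_classical all_reals all_analysis.
From mathcomp Require Import lra.
Import Order.TTheory GRing.Theory Num.Theory.
Import numFieldNormedType.Exports.
Local Open Scope classical_set_scope.
Local Open Scope ring_scope.

(** Let [P] and [N] be the sets of points of [I] at which [F] has a positive,
    respectively negative, value.  Both are relatively open by lower
    semicontinuity, and [F] is quasimonotone iff no point of [P] lies to the
    left of a point of [N].  Local quasimonotonicity on the dense set [J] makes
    [P] and [N] disjoint.  If [a < b], [P a] and [N b], then
    [s := sup (P `&` [a, b])] is in neither set, so [F s = {0}] and thus
    [s] is in [J].  Points of [P `&` J] accumulate at [s] from the left, while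
    local strictness gives points of [N `&` J] just to the right of [s], since
    no point of [P] lies in [(s, b)]: this contradicts quasimonotonicity
    near [s]. *)

Definition takes_pos {R : realType} (F : R -> set R) : set R :=
  [set x | F x `&` [set r | 0 < r] !=set0].

Definition takes_neg {R : realType} (F : R -> set R) : set R :=
  [set x | F x `&` [set r | r < 0] !=set0].

Lemma takes_pos_nbhs {R : realType} {I : set R} {F : R -> set R} {x : R} :
  set_valued_lsc I F -> I x -> takes_pos F x ->
  \forall y \near x, I y -> takes_pos F y.
Proof.
move=> hlsc Ix /(hlsc x Ix _ (@open_gt R 0))[M Mx MF].
by apply: filterS Mx => y My Iy; apply: MF.
Qed.

Lemma takes_neg_nbhs {R : realType} {I : set R} {F : R -> set R} {x : R} :
  set_valued_lsc I F -> I x -> takes_neg F x ->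
  \forall y \near x, I y -> takes_neg F y.
Proof.
move=> hlsc Ix /(hlsc x Ix _ (@open_lt R 0))[M Mx MF].
by apply: filterS Mx => y My Iy; apply: MF.
Qed.

Lemma takes_pos_or_neg {R : realType} {F : R -> set R} {x : R} :
  F x !=set0 -> ~ F x 0 -> takes_pos F x \/ takes_neg F x.
Proof.
move=> [r Fr] F0; have [r0|r0|r0] := ltgtP r 0.
- by right; exists r.
- by left; exists r.
- by case: F0; rewrite -r0.
Qed.

Lemma quasimonotone_lt {R : realType} {A : set R} {F : R -> set R} {x y : R} :
  quasimonotone A F -> A x -> A y -> x < y ->
  takes_pos F x -> takes_neg F y -> False.
Proof.
move=> qF Ax Ay xy [u [Fu /= u0]] [v [Fv /= v0]].
have := qF x y Ax Ay u v Fu Fv; rewrite pmulr_lgt0 ?subr_gt0// => /(_ u0).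
by rewrite pmulr_lge0 ?subr_gt0// leNgt v0.
Qed.

Lemma lt_quasimonotone {R : realType} {A : set R} {F : R -> set R} :
  (forall x y, A x -> A y -> x < y ->
     takes_pos F x -> takes_neg F y -> False) ->
  quasimonotone A F.
Proof.
move=> sepF x y Ax Ay u v Fu Fv; have [xy|yx|->] := ltgtP x y.
- rewrite pmulr_lgt0 ?subr_gt0// pmulr_lge0 ?subr_gt0// => u0.
  by rewrite leNgt; apply/negP => v0; apply: (sepF x y) => //; [exists u|exists v].
- rewrite nmulr_lgt0 ?subr_lt0// nmulr_lge0 ?subr_lt0// => u0.
  by rewrite leNgt; apply/negP => v0; apply: (sepF y x) => //; [exists v|exists u].
- by rewrite subrr !mulr0 ltxx.
Qed.

Lemma open_segment_lt {R : realType} {x y z : R} :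
  x < y -> open_segment x y z <-> x < z < y.
Proof.
move=> xy; split.
  move=> [t /=]; rewrite in_itv/= => /andP[t0 t1] <-.
  have d0 : 0 < y - x by rewrite subr_gt0.
  by apply/andP; split; nra.
move=> /andP[xz zy]; have d0 : 0 < y - x by rewrite subr_gt0.
exists ((z - x) / (y - x)); last by rewrite divfK ?gt_eqF// addrC subrK.
by rewrite /= in_itv/= ltr_pdivlMr// mul0r ltr_pdivrMr//; apply/andP; split; lra.
Qed.

Lemma open_segmentC {R : realType} (x y : R) :
  open_segment x y `<=` open_segment y x.
Proof.
move=> z [t /=]; rewrite in_itv/= => /andP[t0 t1] <-.
by exists (1 - t); [rewrite /= in_itv/=; apply/andP; split; lra | lra].
Qed.

(** As [y - x] is nonzero, the condition on [zs * (y - x)] only says that [zs] is nonzero; as the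
    segment ignores the order of its endpoints, pairs with [x < y] suffice. *)
Lemma strictly_quasimonotoneP {R : realType} {A : set R} {F : R -> set R} :
  strictly_quasimonotone A F <->
  quasimonotone A F /\
  forall x y, A x -> A y -> x < y ->
    exists z, [/\ A z, x < z < y & takes_pos F z \/ takes_neg F z].
Proof.
split=> -[qF sF]; split=> // x y Ax Ay xy.
  have [|z [sz Az] [w Fw w0]] := sF x y Ax Ay; first by rewrite lt_eqF.
  exists z; split=> //; first exact/open_segment_lt.
  have [w_lt|w_gt|wE] := ltgtP w 0.
  - by right; exists w.
  - by left; exists w.
  - by rewrite wE mul0r eqxx in w0.
have neq0 z : takes_pos F z \/ takes_neg F z ->
    exists2 w, F z w & w * (y - x) != 0.
  have yx0 : y - x != 0 by rewrite subr_eq0 eq_sym.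
  by case=> -[w [Fw /= w0]]; exists w => //; rewrite mulf_neq0// neq_lt w0 ?orbT.
have [lt_xy|lt_yx] : x < y \/ y < x by apply/orP; rewrite -neq_lt.
  have [z [Az xzy /neq0 ?]] := sF x y Ax Ay lt_xy.
  by exists z => //; split=> //; apply/open_segment_lt.
have [z [Az yzx /neq0 ?]] := sF y x Ay Ax lt_yx.
by exists z => //; split=> //; apply/open_segmentC/open_segment_lt.
Qed.

(** Cutting a ball around [p] down to [(a, b)] leaves a nonempty open interval, whose midpoint is in
    [I], hence in the closure of [J]. Allowing [p] to be an endpoint gives points of [J] close to
    [p] on a chosen side. *)
Lemma dense_interval_meets {R : realType} {I J V : set R} {a b p : R} :
  is_interval I -> I `<=` closure J -> I a -> I b -> a < b -> a <= p <= b ->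
  nbhs p V -> exists j, [/\ J j, V j & a < j < b].
Proof.
move=> hI hJ Ia Ib ab /andP[ap pb] /nbhs_ballP[e /= e0 eV].
pose l := Num.max a (p - e); pose r := Num.min b (p + e).
have lr : l < r by rewrite lt_min !gt_max ab /=; apply/and3P; split; lra.
have /hJ Jm : I ((l + r) / 2).
  apply: (hI a b) => //.
  have al : a <= l by rewrite le_max lexx.
  have rb : r <= b by rewrite ge_min lexx.
  by apply/andP; split; lra.
have [|j [Jj /=]] := Jm `]l, r[%classic.
  by apply: near_in_itvoo; rewrite in_itv/= !midf_lt.
rewrite in_itv/= lt_min gt_max => /andP[/andP[aj pj] /andP[jb jp]].
exists j; split=> //; last by rewrite aj.
by apply: eV; rewrite /ball/= ltr_distl; apply/andP; split; lra.
Qed.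

(** Both signs would persist near [p], so two nearby points [j < k] of [J] would violate
    quasimonotonicity around [j]. The bounds [a < b] exclude a one-point [I], where [F] may take
    both signs. *)
Lemma takes_pos_neg_disjoint {R : realType} {I J : set R} {F : R -> set R}
    {a b p : R} :
  is_interval I -> set_valued_lsc I F -> J `<=` I -> I `<=` closure J ->
  locally_strictly_quasimonotone J F ->
  I a -> I b -> a < b -> a <= p <= b ->
  takes_pos F p -> takes_neg F p -> False.
Proof.
move=> hI hlsc hJI hJ hloc Ia Ib ab apb Pp Np.
have Ip : I p by apply: (hI a b).
(* Passing to the interior makes this set a neighborhood of the point [j] chosen in it, so that [k]
   can be sought near [j]. *)
have /nbhs_interior PN : nbhs p [set y | I y -> takes_pos F y /\ takes_neg F y].
  have nP := takes_pos_nbhs hlsc Ip Pp.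
  have nN := takes_neg_nbhs hlsc Ip Np.
  by near=> y => Iy; split; [apply: (near nP y)|apply: (near nN y)].
have [j [Jj jPN /andP[aj jb]]] := dense_interval_meets hI hJ Ia Ib ab apb PN.
have [U [oU Uj /strictly_quasimonotoneP[qU _]]] := hloc j Jj.
have [k [Jk [Uk kPN] /andP[jk _]]] : exists k, [/\ J k,
    (U `&` [set y | I y -> takes_pos F y /\ takes_neg F y]) k & j < k < b].
  apply: (@dense_interval_meets _ _ _ _ _ _ j hI hJ) => //; first exact: hJI.
    by rewrite lexx ltW.
  by apply: filterI => //; apply: open_nbhs_nbhs.
have [Pj _] := nbhs_singleton jPN (hJI _ Jj).
have [_ Nk] := kPN (hJI _ Jk).
by apply: (@quasimonotone_lt _ _ _ j k qU).
Unshelve. all: by end_near. Qed.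

Theorem theorem3p1 (R : realType) (I J : set R) (F : R -> set R)
    (hI : is_interval I)
    (hF : nonempty_valued I F)
    (hlsc : set_valued_lsc I F)
    (hJI : J `<=` I)
    (hJ : I `<=` closure J)
    (hloc : locally_strictly_quasimonotone J F)
    (h0 : forall x, (I `\` J) x -> ~ F x 0) :
  strictly_quasimonotone I F.
Proof.
apply/strictly_quasimonotoneP; split; last first.
  (* Strictness: local strictness is applied between two points [j < k] of [J] lying in [(x, y)],
     with [k] close to [j]. *)
  move=> x y Ix Iy xy.
  have [|j [Jj _ /andP[xj jy]]] :=
    @dense_interval_meets _ _ _ _ _ _ x hI hJ Ix Iy xy _ filterT.
    by rewrite lexx ltW.
  have [U [oU Uj /strictly_quasimonotoneP[_ sU]]] := hloc j Jj.
  have [||k [Jk Uk /andP[jk ky]]] :=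
    @dense_interval_meets _ _ _ U _ _ j hI hJ (hJI _ Jj) Iy jy.
  - by rewrite lexx ltW.
  - exact: open_nbhs_nbhs.
  have [z [[_ Jz] /andP[jz zk] Fz]] := sU j k (conj Uj Jj) (conj Uk Jk) jk.
  by exists z; split; [exact: hJI|rewrite (lt_trans xj) ?(lt_trans zk)|].
apply: lt_quasimonotone => a b Ia Ib ab Pa Nb.
have disj p : a <= p <= b -> takes_pos F p -> takes_neg F p -> False.
  exact: (takes_pos_neg_disjoint hI hlsc hJI).
pose S := [set t | a <= t <= b /\ takes_pos F t].
have Sa : S a by split; rewrite // lexx ltW.
have supS : has_sup S by split; [exists a|exists b => t [/andP[]]].
pose s := sup S.
have S_le t : S t -> t <= s by move=> St; apply: ub_le_sup => //; apply: supS.2.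
have sb : s <= b by apply: ge_sup; [exists a|move=> t [/andP[]]].
have asb : a <= s <= b by rewrite S_le.
have Is : I s by apply: (hI a b).
have S_near V : nbhs s V -> exists2 t, S t & V t.
  move=> /nbhs_ballP[e /= e0 eV].
  have [t St et] := sup_adherent e0 supS.
  exists t => //; apply: eV; rewrite /ball/= ltr_distl.
  by have := S_le t St; rewrite -/s in et *; move=> ts; apply/andP; split; lra.
(* A negative value at [s] would persist at points of [S] close to [s], against disjointness. *)
have nNs : ~ takes_neg F s.
  move=> /(takes_neg_nbhs hlsc Is)/S_near[t [atb Pt] Nt].
  by apply: (disj t) => //; apply/Nt/(hI a b).
have s_lt_b : s < b.
  by rewrite lt_neqAle sb andbT; apply/eqP => sE; apply: nNs; rewrite sE.
have right_nP t : s < t -> t < b -> ~ takes_pos F t.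
  move=> st tb Pt; have /S_le : S t; last by rewrite leNgt st.
  by split=> //; rewrite (ltW tb) andbT (le_trans _ (ltW st))// S_le.
(* A positive value at [s] would persist at points of [J] just beyond the supremum. *)
have nPs : ~ takes_pos F s.
  move=> /(takes_pos_nbhs hlsc Is) Ps.
  have [|t [Jt Pt /andP[st tb]]] :=
    dense_interval_meets hI hJ Is Ib s_lt_b _ Ps.
    by rewrite lexx ltW.
  exact: right_nP st tb (Pt (hJI _ Jt)).
have Js : J s.
  apply: contrapT => nJs.
  by have [] := takes_pos_or_neg (hF s Is) (h0 s (conj Is nJs)).
have [U [oU Us /strictly_quasimonotoneP[qU sU]]] := hloc s Js.
have nU : nbhs s U by exact: open_nbhs_nbhs.
have [|k [Jk Uk /andP[sk kb]]] :=
  @dense_interval_meets _ _ _ U _ _ s hI hJ Is Ib s_lt_b _ nU.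
  by rewrite lexx ltW.
have [z [[Uz Jz] /andP[sz zk] Fz]] := sU s k (conj Us Js) (conj Uk Jk) sk.
have Nz : takes_neg F z.
  by case: Fz => // /right_nP; case; rewrite // (lt_trans zk).
have [t [atb Pt] Ut] := S_near U nU.
have It : I t by apply: (hI a b).
have ts : t < s.
  rewrite lt_neqAle (S_le t)// andbT; apply/eqP => tE.
  by apply: nPs; rewrite -tE.
(* The point [t] need not lie in [J]; density replaces it by a nearby [j] in [J] that is still in
   [U], left of [s], and has a positive value. *)
have [|j [Jj [[Uj js] Pj]]] := hJ t It
    (U `&` [set y | y < s] `&` [set y | I y -> takes_pos F y]).
  apply: filterI; last exact: takes_pos_nbhs.
  by apply: filterI; [exact: open_nbhs_nbhs|exact: lt_nbhsl].
apply: (@quasimonotone_lt _ _ _ j z qU) => //; first exact: lt_trans sz.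
exact/Pj/hJI.
Qed.
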